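(* Let $\mathcal R_2$ denote the set of partitions in which any two parts differ by at least 2 and in which 1 is not a part. For $\tilde\pi\in\mathcal R_2$ let $\omega_2(\tilde\pi)=2^r$, where $r$ is the number of even chains $\chi$ in $\tilde\pi$ with $\lambda(\chi)>2$. Let $A_{6,1}(n)$ denote the number of partitions of $n$ into parts $\not\equiv 0,\pm1 \pmod 6$. Then, for every $n\ge 0$, $$A_{6,1}(n)=\sum_{\tilde\pi\in\mathcal R_2,\ \sigma(\tilde\pi)=n}\omega_2(\tilde\pi).$$
   Context: For a partition $\pi$, $\sigma(\pi)$ denotes the sum of its parts. In a partition whose parts pairwise differ by at least 2, a chain $\chi$ is a maximal block of parts in which consecutive parts differ by exactly 2; such a partition decomposes uniquely into chains, and all parts of a chain have the same parity. A chain is even if its parts are even. $\lambda(\chi)$ denotes the least part of the chain $\chi$. *)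

(* Defs.v *)
From HB Require Import structures.
From mathcomp Require Import all_boot.
Set Implicit Arguments.
Unset Strict Implicit.
Unset Printing Implicit Defensive.

(* A partition of n is its sequence of parts in weakly decreasing order. *)
Definition is_intpart (n : nat) (s : seq nat) : bool :=
  [&& sorted geq s, 0 \notin s & sumn s == n].

Record intpart (n : nat) : Type :=
  IntPart { parts :> seq nat; _ : is_intpart n parts }.

HB.instance Definition _ n := [isSub for @parts n].
HB.instance Definition _ n := [Countable of intpart n by <:].

Lemma leq_part_sumn (s : seq nat) (x : nat) : x \in s -> x <= sumn s.
Proof.
elim: s => //= y s IHs; rewrite inE => /predU1P[->|/IHs]; first exact: leq_addr.
by move=> /leq_trans; apply; exact: leq_addl.
Qed.

Lemma size_leq_sumn (s : seq nat) : 0 \notin s -> size s <= sumn s.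
Proof.
elim: s => //= y s IHs; rewrite inE negb_or => /andP[y0 /IHs ss].
by rewrite -add1n leq_add // lt0n eq_sym.
Qed.

(* A partition of n has at most n parts, each at most n, so intpart n embeds in
   the finite type of bounded sequences n.-bseq 'I_n.+1. *)
Definition intpart_code n (p : intpart n) : n.-bseq 'I_n.+1 :=
  insub_bseq n [seq inord x | x <- p].
Definition intpart_decode n (b : n.-bseq 'I_n.+1) : option (intpart n) :=
  insub [seq val i | i <- b].

Lemma intpart_codeK n : pcancel (@intpart_code n) (@intpart_decode n).
Proof.
case=> s s_n; have /and3P[_ s0 /eqP sum_s] := s_n.
have size_s : size s <= n by rewrite -sum_s size_leq_sumn.
rewrite /intpart_decode /intpart_code val_insubd size_map /= size_s.
have -> : [seq val i | i <- [seq (inord x : 'I_n.+1) | x <- s]] = s.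
  rewrite -map_comp -[RHS]map_id; apply/eq_in_map => x /leq_part_sumn.
  by rewrite sum_s => x_n /=; rewrite inordK.
by rewrite /= insubT.
Qed.

HB.instance Definition _ n : isFinite (intpart n) :=
  PCanIsFinite (@intpart_codeK n).

(* x is congruent to -1 mod 6 iff x + 1 is congruent to 0. *)
Definition A61_part (x : nat) : bool :=
  [&& x != 0 %[mod 6], x != 1 %[mod 6] & x + 1 != 0 %[mod 6]].

Definition A61 (n : nat) : nat := #|[set p : intpart n | all A61_part p]|.

Definition R2 (s : seq nat) : bool :=
  pairwise (fun x y => y + 2 <= x) s && (1 \notin s).

Definition step2 (x y : nat) : bool := x == y + 2.

(* For a decreasing sequence of parts, its chains in order: a new part x joins
   the chain just below it exactly when it exceeds its largest part by 2. *)
Fixpoint chains (s : seq nat) : seq (seq nat) :=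
  if s is x :: s' then
    if chains s' is (y :: c) :: cs then
      if step2 x y then (x :: y :: c) :: cs else [:: x] :: (y :: c) :: cs
    else [:: [:: x]]
  else [::].

(* cs cuts s into nonempty consecutive blocks in which consecutive parts differ
   by exactly 2, and no two neighbouring blocks can be merged. *)
Definition chain_decomposition (s : seq nat) (cs : seq (seq nat)) : Prop :=
  [/\ flatten cs = s,
      all (fun c => (c != [::]) && sorted step2 c) cs &
      sorted (fun c d => ~~ step2 (last 0 c) (head 0 d)) cs].

Lemma chain_decompositionP (s : seq nat) (cs : seq (seq nat)) :
  chain_decomposition s cs <-> cs = chains s.
Proof.
split=> [|->{cs}]; last first.
  elim: s => [|x s [IHf IHa IHs]] //=.
  case: (chains s) IHf IHa IHs => [|[|y c] cs] //=.
    by move=> <-.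
  move=> <- /andP[pc acs] scs; case: ifP => xy; split=> //=;
    rewrite ?xy ?pc ?acs //.
  by case: (cs) scs.
elim: s cs => [|x s IHs] [|[|x' c] cs] //=; try by case.
case=> /= -[-> flat_s] /andP[sc acs] scs.
case: c sc flat_s scs => [|y c] /=.
  move=> _ flat_s scs; have := IHs cs; rewrite -flat_s => <-; last first.
    by split=> //; case: (cs) scs => //= d ds /andP[].
  by case: cs acs scs {flat_s} => [|[|y d] ds] //= _ /andP[/negbTE->].
case/andP=> xy pc flat_s scs.
by rewrite -(IHs ((y :: c) :: cs)) ?xy //; split=> //=;
  [rewrite pc | case: (cs) scs].
Qed.

(* Parts are listed decreasingly, so the least part of a chain is its last. *)
Definition chain_least (c : seq nat) : nat := last 0 c.

Definition even_chain (c : seq nat) : bool := all (fun x => ~~ odd x) c.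

Definition omega2 (s : seq nat) : nat :=
  2 ^ count (fun c => even_chain c && (2 < chain_least c)) (chains s).

(* Main.v *)
Require Import Defs.
From mathcomp Require Import all_boot all_algebra.
From mathcomp Require Import qpoly ring zify.
Set Implicit Arguments.
Unset Strict Implicit.
Unset Printing Implicit Defensive.
Import GRing.Theory Num.Theory.

(** Both sides count, with weights, the increasing sequences of positive
integers with sum n, and in both cases the weight is a product of local
factors k m x, one for each pair of consecutive parts m, x (the first part is
paired with a fixed starting value).  For the gap side the starting value is 0:
a part x is the least part of an even chain exactly when x is even and the
preceding part is not x - 2, and the condition that the chain does not start
at 2 becomes the same condition with preceding part 0.  So the factor is 0 if
the gap is less than 2, 2 if x is even and the gap is not 2, and 1 otherwise
(lemma R2_kernel_path).

Let V(m) be the generating function of the weighted sequences whose parts are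
preceded by m, so that V(0) is the right-hand side.  Comparing V(m) with
V(m+1) gives a linear recurrence, and eliminating the odd arguments gives, with
z = q^(2l) and v(z) = V(2l),

  v(z) = (1 + z q^2 + z q^3) v(z q^2) + z q^4 (1 - z q^3) v(z q^4).

As v(z) tends to 1 when l grows, this determines v, and a limiting case of
Watson's transformation of a very-well-poised series into a balanced one
provides the solution:

  v(z) = sum_{r >= 0} (-1)^r z^(2r) q^(3r^2 + 2r) (1 - z q^(4r+2))
           (-q; q)_{2r} (-z q^(2r+2); q)_oo
           / ((q^2; q^2)_r (z q^(2r+2); q^2)_oo).

That the series satisfies the recurrence is checked by creative telescoping
(lemma series_telescope).  At z = 1 it collapses to

  (q; q)_oo V(0) = sum_{r >= 0} (-1)^r q^(3r^2 + 2r) (1 - q^(2r+1)),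

and the Jacobi triple product turns the theta series into the product of
(q; q^6)_oo, (q^5; q^6)_oo and (q^6; q^6)_oo (lemma theta_prod).  Hence V(0)
is the reciprocal of (q^2; q^6)_oo (q^3; q^6)_oo (q^4; q^6)_oo, which is the
generating function of the partitions into parts congruent to 2, 3 or 4
modulo 6.

Formal power series are only needed modulo q^K.  The computations take place
in any commutative ring with an element q such that q^K = 0: there 1 - q^a is
a unit for a > 0, infinite sums and products are finite, and z = q^(2l)
vanishes for large l.  The ring of rational polynomials modulo X^K finally
returns the coefficients (lemma weight_count_eq). *)

(** * Weighted sequences of positive integers *)

Fixpoint path_weight (k : nat -> nat -> nat) (m : nat) (s : seq nat) : nat :=
  if s is x :: s' then k m x * path_weight k x s' else 1.

Lemma path_weight_rcons k m s x :
  path_weight k m (rcons s x) = path_weight k m s * k (last m s) x.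
Proof.
by elim: s m => /= [|y s IHs] m; [rewrite mul1n muln1 | rewrite IHs mulnA].
Qed.

Lemma path_weight_rev k m x s :
  path_weight k m (rev (x :: s)) = path_weight k m (rev s) * k (head m s) x.
Proof.
rewrite rev_cons path_weight_rcons; case: s => // y s.
by rewrite rev_cons last_rcons.
Qed.

(** The compositions of n.  The fuel f bounds the recursion depth, and every
value f >= n gives the same list up to order. *)
Fixpoint compositions (f n : nat) : seq (seq nat) :=
  if n is 0 then [:: [::]]
  else if f is f'.+1 then
    [seq x :: s | x <- iota 1 n, s <- compositions f' (n - x)]
  else [::].

Lemma compositionsSS f n :
  compositions f.+1 n.+1 =
  [seq x :: s | x <- iota 1 n.+1, s <- compositions f (n.+1 - x)].
Proof. by []. Qed.

Lemma mem_compositions f n s :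
  n <= f -> (s \in compositions f n) = (0 \notin s) && (sumn s == n).
Proof.
elim: f n s => [|f IHf] [|n] // s le_nf; rewrite ?compositionsSS.
- by case: s => // -[|x] s; rewrite !inE //= andbF.
- by case: s => // -[|x] s; rewrite !inE //= andbF.
apply/allpairsPdep/andP => [[x [t []]]|].
  rewrite mem_iota => x_n.
  rewrite IHf => [/andP[t0 /eqP sum_t] ->|]; last by lia.
  by rewrite inE negb_or t0 /= sum_t; split; lia.
case: s => [|x s] []; first by [].
rewrite inE negb_or [sumn _]/= => /andP[x0 s0] /eqP sum_s.
exists x, s; split; [rewrite mem_iota; lia | rewrite IHf ?s0; lia | by []].
Qed.

Lemma uniq_compositions f n : uniq (compositions f n).
Proof.
elim: f n => [|f IHf] [|n] //; rewrite compositionsSS.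
apply: allpairs_uniq_dep => [|x _|[x s] [y t] _ _ /= [-> ->]] //.
exact: iota_uniq.
Qed.

Definition weight_count k m n := \sum_(s <- compositions n n) path_weight k m s.

Lemma weight_count_fuel k m f n :
  n <= f -> \sum_(s <- compositions f n) path_weight k m s = weight_count k m n.
Proof.
move=> le_nf; apply/perm_big/uniq_perm; rewrite ?uniq_compositions // => s.
by rewrite !mem_compositions.
Qed.

Lemma weight_count0 k m : weight_count k m 0 = 1.
Proof. by rewrite /weight_count big_seq1. Qed.

Lemma weight_countS k m n :
  weight_count k m n.+1 =
  \sum_(1 <= x < n.+2) k m x * weight_count k x (n.+1 - x).
Proof.
rewrite /weight_count compositionsSS big_allpairs_dep /index_iota subn1.
rewrite !big_seq; apply: eq_bigr => x; rewrite mem_iota => x_n.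
rewrite -big_distrr /= -/path_weight; congr (_ * _).
by apply: weight_count_fuel; lia.
Qed.

(** Reversal identifies the partitions of n with the sorted compositions, and
the other compositions do not contribute. *)
Lemma sum_intpart n (f : seq nat -> nat) :
    (forall s, ~~ sorted leq s -> f s = 0) ->
  \sum_(p : intpart n) f (rev p) = \sum_(s <- compositions n n) f s.
Proof.
move=> f0; rewrite (bigID (sorted leq)) /= [X in _ + X]big1 => [|s /f0 //].
rewrite addn0 -[RHS]big_filter -(big_map (fun p : intpart n => rev p) xpredT f).
apply: perm_big; apply: uniq_perm.
- by rewrite map_inj_uniq ?index_enum_uniq // => p r /(can_inj revK)/val_inj.
- by rewrite filter_uniq ?uniq_compositions.
move=> s; rewrite mem_filter mem_compositions //.
apply/mapP/and3P => [[p _ ->]|].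
  case: p => p /= /and3P[sp p0 sum_p]; rewrite rev_sorted mem_rev p0 sumn_rev.
  by split.
case=> ss s0 sum_s; have Ps : is_intpart n (rev s).
  by apply/and3P; rewrite rev_sorted mem_rev sumn_rev.
by exists (IntPart Ps); rewrite ?mem_index_enum //= revK.
Qed.

Definition A61_kernel m x : nat := (m <= x) && A61_part x.

Lemma A61_kernel_path m s :
  path_weight A61_kernel m s = path leq m s && all A61_part s.
Proof.
elim: s m => //= x s IHs m; rewrite IHs /A61_kernel mulnb.
by congr nat_of_bool; rewrite -!andbA; do !bool_congr.
Qed.

Lemma A61_count n : A61 n = weight_count A61_kernel 1 n.
Proof.
rewrite /A61 /weight_count -(@sum_intpart n) => [|s]; last first.
  rewrite A61_kernel_path; case: (boolP (path _ _ _)) => // /path_sorted.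
  by move=> ->.
rewrite cardsE -sum1_card big_mkcond; apply: eq_bigr => -[p Pp] _ /=.
have /and3P[sp p0 _] := Pp; rewrite A61_kernel_path all_rev unfold_in /=.
have -> : path leq 1 (rev p).
  rewrite path_min_sorted ?rev_sorted //.
  rewrite all_rev; apply/allP => x xp.
  by rewrite lt0n; apply: contraNneq p0 => <-.
by case: all.
Qed.

Definition R2_kernel m x : nat :=
  if m + 2 <= x then (if ~~ odd x && (x != m + 2) then 2 else 1) else 0.

Lemma chains_cons y s : exists c cs, chains (y :: s) = (y :: c) :: cs.
Proof.
rewrite /=; case: (chains s) => [|[|z c] cs]; try by exists [::], [::].
by case: ifP => _; [exists (z :: c), cs | exists [::], ((z :: c) :: cs)].
Qed.

Lemma R2_cons2 x y s :
  R2 [:: x, y & s] = [&& y + 2 <= x, x != 1 & R2 (y :: s)].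
Proof.
rewrite /R2 /= !inE !negb_or (eq_sym x).
have [le_yx|_] := leqP (y + 2) x; last by [].
have [y_s|_] := boolP (all (fun z => z + 2 <= y) s); last by rewrite !andbF.
have -> : all (fun z => z + 2 <= x) s.
  by apply: sub_all y_s => z /leq_trans -> //; lia.
by case: pairwise; rewrite ?andbF //=; case: (1 != x).
Qed.

(** A new largest part x at distance 2 above y has the parity of y and joins
its chain without changing the least part, so the weight is unchanged.
Otherwise x starts a chain of its own, which counts when x is even; x > 2 then
follows from y >= 1.  For a single part, the starting value 0 excludes 1 and
leaves the part 2 unweighted. *)
Lemma R2_kernel_path s : 0 \notin s ->
  path_weight R2_kernel 0 (rev s) = if R2 s then omega2 s else 0.
Proof.
elim: s => // x [_|y s IHs].
  rewrite inE => x0; rewrite /= muln1 /R2 /= inE /R2_kernel.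
  rewrite /omega2 /= /chain_least /even_chain /= !andbT addn0 add0n eq_sym.
  case: x x0 => [|[|[|x]]] //= _.
  by case: (odd x).
rewrite inE negb_or => /andP[x0 /[dup] ys0 /IHs {}IHs].
rewrite path_weight_rev {}IHs R2_cons2 /R2_kernel -[head 0 (y :: s)]/y.
have y_gt0 : 0 < y by move: ys0; rewrite inE negb_or lt0n eq_sym => /andP[].
have [le_yx|] := leqP (y + 2) x; last by rewrite muln0.
have -> : x != 1 by lia.
case: ifP => //= _; rewrite /omega2.
have [c [cs]] := chains_cons y s; rewrite /= => ->; rewrite /step2.
have [->|ne_xy] /= := eqVneq x (y + 2).
  by rewrite andbF muln1 oddD addbF andbA andbb.
rewrite andbT /chain_least /even_chain /=.
have -> : 2 < x by lia.
by case: (odd x); rewrite /= ?muln1 // mulnC -expnS.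
Qed.

Lemma path_weight_sorted k m s :
    (forall y x, k y x != 0 -> y <= x) ->
  ~~ sorted leq s -> path_weight k m s = 0.
Proof.
move=> k_le; apply: contraNeq; elim: s m => //= x s IHs m.
rewrite muln_eq0 negb_or => /andP[_ s_neq0].
rewrite path_min_sorted ?(IHs x) //.
elim: s x s_neq0 {IHs} => //= y s IHs x; rewrite muln_eq0 negb_or.
case/andP=> /k_le le_xy /IHs y_s; rewrite le_xy /=.
by apply: sub_all y_s => z; apply: leq_trans.
Qed.

Lemma R2_count n :
  \sum_(p : intpart n | R2 p) omega2 p = weight_count R2_kernel 0 n.
Proof.
rewrite /weight_count -sum_intpart => [|s].
  rewrite big_mkcond; apply: eq_bigr => -[p Pp] _ /=; have /and3P[_ p0 _] := Pp.
  by rewrite R2_kernel_path.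
by apply: path_weight_sorted => y x; rewrite /R2_kernel; case: leqP => //; lia.
Qed.

(** * Power series truncated at order K *)

Section TruncatedSeries.
Local Open Scope ring_scope.
Context (R : comUnitRingType) (q : R) (K : nat) (qK : q ^+ K = 0).

Lemma truncation_gt0 : (0 < K)%N.
Proof. by case: K qK => // /eqP; rewrite expr0 oner_eq0. Qed.

Lemma expq_ge m : (K <= m)%N -> q ^+ m = 0.
Proof. by move=> le_Km; rewrite -(subnKC le_Km) exprD qK mul0r. Qed.

(** c * q^a is nilpotent when a > 0, so a finite geometric series inverts
1 + c * q^a. *)
Lemma unit_one_add c a : (0 < a)%N -> 1 + c * q ^+ a \is a GRing.unit.
Proof.
move=> a_gt0; set y := c * q ^+ a.
have yK : (- y) ^+ K = 0.
  rewrite -mulNr exprMn -exprM [X in _ * X]expq_ge ?mulr0 //.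
  by rewrite leq_pmull.
apply/unitrP; exists (\sum_(i < K) (- y) ^+ i).
suff E : (1 + y) * \sum_(i < K) (- y) ^+ i = 1 by rewrite mulrC E.
have := subrX1 (- y) K; rewrite yK sub0r => /(congr1 -%R).
by rewrite opprK -mulNr opprD !opprK addrC => <-.
Qed.

Lemma unit_one_sub a : (0 < a)%N -> 1 - q ^+ a \is a GRing.unit.
Proof. by move=> a_gt0; rewrite -mulN1r unit_one_add. Qed.

(** The q-Pochhammer symbol (- c q^a; q^s)_n; the parameter c is 1 or -1 in
its uses. *)
Definition qprod c a s n : R := \prod_(i < n) (1 + c * q ^+ (a + s * i)).

Lemma qprod0 c a s : qprod c a s 0 = 1.
Proof. by rewrite /qprod big_ord0. Qed.

Lemma qprod_recl c a s n :
  qprod c a s n.+1 = (1 + c * q ^+ a) * qprod c (a + s) s n.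
Proof.
rewrite /qprod big_ord_recl muln0 addn0; congr (_ * _).
by apply: eq_bigr => i _; rewrite lift0 mulnS addnA.
Qed.

Lemma qprod_recr c a s n :
  qprod c a s n.+1 = qprod c a s n * (1 + c * q ^+ (a + s * n)).
Proof. by rewrite /qprod big_ord_recr. Qed.

Lemma unit_qprod c a s n : (0 < a)%N -> qprod c a s n \is a GRing.unit.
Proof.
move=> a_gt0; rewrite /qprod; apply: (big_ind (fun y => y \is a GRing.unit)).
- exact: unitr1.
- by move=> x y; rewrite unitrM => -> ->.
- by move=> i _; rewrite unit_one_add // addn_gt0 a_gt0.
Qed.

Lemma qprod_stable c a s n m :
  (K <= a + s * n)%N -> (n <= m)%N -> qprod c a s m = qprod c a s n.
Proof.
move=> le_K /subnKC <-; elim: (m - n)%N => [|k IHk]; first by rewrite addn0.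
rewrite addnS qprod_recr IHk expq_ge ?mulr0 ?addr0 ?mulr1 //.
by apply: leq_trans le_K _; rewrite leq_add2l leq_mul2l leq_addr orbT.
Qed.

(** For s > 0, the factors beyond the first K are equal to 1, so that this is
the infinite product (- c q^a; q^s)_oo. *)
Definition qinf c a s : R := qprod c a s K.

Lemma qinf_recl c a s :
  (0 < s)%N -> qinf c a s = (1 + c * q ^+ a) * qinf c (a + s) s.
Proof.
move=> s_gt0; rewrite -qprod_recl; apply/esym/qprod_stable => //.
by rewrite (leq_trans _ (leq_addl _ _)) // leq_pmull.
Qed.

Lemma unit_qinf c a s : (0 < a)%N -> qinf c a s \is a GRing.unit.
Proof. exact: unit_qprod. Qed.

Lemma qinf_ge c a s : (K <= a)%N -> qinf c a s = 1.
Proof.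
move=> le_Ka; rewrite /qinf /qprod big1 // => i _.
by rewrite expq_ge ?mulr0 ?addr0 // (leq_trans le_Ka) ?leq_addr.
Qed.

Lemma qinf_split c a s r : (0 < s)%N ->
  qinf c a s = qprod c a s r * qinf c (a + s * r) s.
Proof.
move=> s_gt0; elim: r => [|r IHr]; first by rewrite qprod0 mul1r muln0 addn0.
by rewrite qprod_recr -mulrA mulnS [(s + _)%N]addnC addnA -qinf_recl.
Qed.

(** From 1 - x^2 = (1 - x) (1 + x), factor by factor. *)
Lemma qinf_mulN : qinf (-1) 2 2 = qinf (-1) 1 1 * qinf 1 1 1.
Proof.
rewrite /qinf /qprod -big_split; apply: eq_bigr => i _ /=.
have -> : (2 + 2 * i = (1 + i) * 2)%N by lia.
by rewrite mul1n exprM; ring.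
Qed.

(** The reciprocals of shifted products thus become multiples of a single one,
and identities between them become polynomial identities. *)
Lemma inv_factor (x y u : R) :
  u \is a GRing.unit -> y \is a GRing.unit -> x = u * y -> y^-1 = u * x^-1.
Proof. by move=> Uu Uy ->; rewrite invrM // mulrC divrK. Qed.

Lemma inv_qinf_recl a s : (0 < a)%N -> (0 < s)%N ->
  (qinf (-1) (a + s) s)^-1 = (1 - q ^+ a) * (qinf (-1) a s)^-1.
Proof.
move=> a_gt0 s_gt0; apply: inv_factor; rewrite ?unit_one_sub //.
  by rewrite unit_qinf // addn_gt0 a_gt0.
by rewrite qinf_recl // mulN1r.
Qed.

Lemma inv_qprod_recr a s n : (0 < a)%N ->
  (qprod (-1) a s n)^-1 = (1 - q ^+ (a + s * n)) * (qprod (-1) a s n.+1)^-1.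
Proof.
move=> a_gt0; apply: inv_factor; rewrite ?unit_qprod //.
  by rewrite unit_one_sub // addn_gt0 a_gt0.
by rewrite qprod_recr mulN1r mulrC.
Qed.

Lemma qprod_mod6 n : qprod (-1) 1 1 (6 * n) =
  qprod (-1) 1 6 n * qprod (-1) 2 6 n * qprod (-1) 3 6 n *
  qprod (-1) 4 6 n * qprod (-1) 5 6 n * qprod (-1) 6 6 n.
Proof.
elim: n => [|n IHn]; first by rewrite /qprod !big_ord0 !mulr1.
rewrite mulnS !(qprod_recr _ _ 6); move: (6 * n)%N IHn => m IHn.
rewrite ![(_ + m)%N]addnC !addnS addn0 !(qprod_recr (-1) 1 1) IHn !mul1n !add1n.
ring.
Qed.

(** * A closed form for the weighted generating function *)

(** With z = q^(2l), this is (-1)^r z^(2r) q^(3r^2 + 2r). *)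
Definition series_monomial r l : R :=
  (-1) ^+ r * q ^+ (4 * l * r + 3 * r ^ 2 + 2 * r).

Definition series_term r l : R :=
  series_monomial r l * (qprod 1 1 1 (2 * r) / qprod (-1) 2 2 r) *
  (qinf 1 (2 * l + 2 * r + 2) 1 / qinf (-1) (2 * l + 2 * r + 2) 2) *
  (1 - q ^+ (2 * l + 4 * r + 2)).

(** The certificate of the telescoping is a polynomial multiple of a common
factor of the r-th terms for l, l+1 and l+2.  Up to sign, its last factor is
1 + x + (q^2 + q^3) x z - q^2 x^2 z + q^5 x^2 z^2 with x = q^(2r): it is a
solution of the linear system given by the coefficients of the monomials
x^i z^j. *)
Definition series_cert r l : R :=
  series_monomial r l * (qprod 1 1 1 (2 * r) / qprod (-1) 2 2 r) *
  (qinf 1 (2 * l + 2 * r + 4) 1 / qinf (-1) (2 * l + 2 * r + 2) 2) *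
  (1 - q ^+ (2 * r)) *
  (q ^+ (2 * l + 4 * r + 2) - 1 - q ^+ (2 * r) -
   (1 + q) * q ^+ (2 * l + 2 * r + 2) - q ^+ (4 * l + 4 * r + 5)).

(** All the products involved are polynomial multiples of the same three:
(-q; q)_{2r} / (q^2; q^2)_{r+1}, (-q^(m+4); q)_oo and 1 / (q^m; q^2)_oo, where
m = 2l + 2r + 2.  After division by them, a polynomial identity in q, q^l and
q^r remains. *)
Lemma series_telescope r l :
  series_term r l
    - (1 + q ^+ (2 * l + 2) + q ^+ (2 * l + 3)) * series_term r l.+1
    - q ^+ (2 * l + 4) * (1 - q ^+ (2 * l + 3)) * series_term r l.+2 =
  series_cert r.+1 l - series_cert r l.
Proof.
rewrite /series_term /series_cert /series_monomial.
move M_def: (4 * l * r + 3 * r ^ 2 + 2 * r)%N => M.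
have -> : (4 * l.+1 * r + 3 * r ^ 2 + 2 * r = M + 4 * r)%N by nia.
have -> : (4 * l.+2 * r + 3 * r ^ 2 + 2 * r = M + 8 * r)%N by nia.
have -> : (4 * l * r.+1 + 3 * r.+1 ^ 2 + 2 * r.+1 = M + 6 * r + 4 * l + 5)%N.
  by rewrite -M_def; ring.
have -> : (2 * r.+1 = 2 * r + 1 + 1)%N by lia.
rewrite (inv_qprod_recr 2 r) // !addn1 !(qprod_recr 1).
set N := qprod 1 1 1 (2 * r); set Qi := (qprod (-1) 2 2 r.+1)^-1.
have -> : (2 * l.+1 + 2 * r + 2 = (2 * l + 2 * r + 2) + 2)%N by lia.
have -> : (2 * l.+2 + 2 * r + 2 = (2 * l + 2 * r + 2) + 2 + 2)%N by lia.
have -> : (2 * l + (2 * r).+2 + 4 = (2 * l + 2 * r + 2) + 1 + 1 + 1 + 1)%N.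
  by lia.
have -> : (2 * l + (2 * r).+2 + 2 = (2 * l + 2 * r + 2) + 2)%N by lia.
have -> : (2 * l + 2 * r + 4 = (2 * l + 2 * r + 2) + 1 + 1)%N by lia.
move m_def: (2 * l + 2 * r + 2)%N => m.
have m_gt0 : (0 < m)%N by lia.
rewrite (@inv_qinf_recl (m + 2) 2) // ?(@inv_qinf_recl m 2) //; last by lia.
have -> : qinf 1 (m + 2 + 2) 1 = qinf 1 (m + 1 + 1 + 1 + 1) 1.
  by congr qinf; lia.
have -> : qinf 1 (m + 2) 1 = qinf 1 (m + 1 + 1) 1 by congr qinf; lia.
rewrite (qinf_recl _ m) // (qinf_recl _ (m + 1)) //.
rewrite (qinf_recl _ (m + 1 + 1)) // (qinf_recl _ (m + 1 + 1 + 1)) //.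
set E := qinf 1 _ 1; set D := (qinf (-1) m 2)^-1.
have pw c n : q ^+ (c * n) = (q ^+ n) ^+ c by rewrite mulnC exprM.
clearbody N Qi E D; rewrite -m_def.
have -> : (2 * l.+1 = 2 * l + 2)%N by lia.
have -> : (2 * l.+2 = 2 * l + 4)%N by lia.
have -> : ((2 * r).+2 = 2 * r + 2)%N by lia.
have -> : (4 * r.+1 = 4 * r + 4)%N by lia.
have -> : (1 + 1 * (2 * r).+1 = 2 * r + 2)%N by lia.
rewrite mul1n (exprS (-1)).
have := (pw 2 l, pw 4 l, pw 2 r, pw 4 r, pw 6 r, pw 8 r).
(* The rewriting by exprD would otherwise split the products as sums. *)
move: (2 * l)%N (4 * l)%N (2 * r)%N (4 * r)%N (6 * r)%N (8 * r)%N => {pw}.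
move=> a2 a4 b2 b4 b6 b8 pw.
rewrite !(exprD q) !pw.
move: (q ^+ M) (q ^+ l) (q ^+ r) ((-1) ^+ r : R) => qM z x sg.
ring.
Qed.

Definition series l : R := \sum_(r < K) series_term r l.

(** The certificate vanishes at r = 0 because of its factor 1 - q^(2r), and at
r = K because q^(3 K^2) = 0. *)
Lemma series_rec l :
  series l = (1 + q ^+ (2 * l + 2) + q ^+ (2 * l + 3)) * series l.+1
           + q ^+ (2 * l + 4) * (1 - q ^+ (2 * l + 3)) * series l.+2.
Proof.
apply/eqP; rewrite -subr_eq0 opprD addrA /series !mulr_sumr -!sumrB.
under eq_bigr => r _ do rewrite series_telescope.
rewrite -(big_mkord xpredT (fun r => series_cert r.+1 l - series_cert r l)).
rewrite telescope_sumr // /series_cert /series_monomial.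
rewrite muln0 subrr mulr0 mul0r subr0.
rewrite expq_ge ?(mulr0, mul0r) //; have := truncation_gt0; nia.
Qed.

(** Here z = 0, so that only the term r = 0 survives. *)
Lemma series_ge l : (K <= 2 * l)%N -> series l = 1.
Proof.
move=> le_K; rewrite /series -(big_mkord xpredT (series_term^~ l)).
rewrite big_ltn ?truncation_gt0 // big_nat big1 => [|r /andP[r_gt0 _]];
  rewrite /series_term /series_monomial.
  rewrite !qinf_ge /qprod ?big_ord0; try lia.
  rewrite (@expq_ge (2 * l + _ + _)); last by lia.
  by rewrite !muln0 !expr0 invr1 subr0 !mulr1 addr0.
by rewrite expq_ge ?(mulr0, mul0r) //; nia.
Qed.

(** The values at large l determine the solution by descending induction. *)
Lemma series_unique (f : nat -> R) :
    (forall l, f l = (1 + q ^+ (2 * l + 2) + q ^+ (2 * l + 3)) * f l.+1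
           + q ^+ (2 * l + 4) * (1 - q ^+ (2 * l + 3)) * f l.+2) ->
    (forall l, (K <= 2 * l)%N -> f l = 1) ->
  f =1 series.
Proof.
move=> f_rec f_ge l; have [n] := ubnP (K - l); elim: n l => // n IHn l le_n.
have [le_K | lt_K] := leqP K (2 * l); first by rewrite f_ge ?series_ge.
by rewrite f_rec series_rec !IHn //; lia.
Qed.

(** * The triple product for the theta series *)

(** The terms j = r and j = - r - 1 of the bilateral sum of
(-1)^j q^(3j^2 + 2j) are put together, so that r ranges over nat. *)
Definition theta : R :=
  \sum_(r < K) (-1) ^+ r * q ^+ (3 * r ^ 2 + 2 * r) * (1 - q ^+ (2 * r + 1)).

Local Notation P n := (qprod (-1) 6 6 n).

(** A finite form of the triple product.  The weight
1 / ((p; p)_{N-j} (p; p)_{N+1+j}), with p = q^6, is the same for j = r and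
j = - r - 1, which again allows these two terms to be grouped. *)
Definition finite_theta_coef N r : R :=
  (-1) ^+ r * q ^+ (3 * r ^ 2 + 2 * r) / (P (N - r) * P (N + r + 1)).

Definition finite_theta N : R :=
  \sum_(r < N.+1) finite_theta_coef N r * (1 - q ^+ (2 * r + 1)).

Definition finite_theta_cert N r : R :=
  - finite_theta_coef N.+1 r * (1 - q ^+ (6 * (N + r + 2))) *
  q ^+ (6 * (N.+1 - r)) *
  (q * (1 - q ^+ (6 * N + 5)) * (q ^+ (6 * r) - q ^+ (2 * r)) +
   (1 - q ^+ (6 * N + 7)) * (1 - q ^+ (8 * r))).

(** The bilateral sum has a Wilf-Zeilberger certificate g_j, and the certificate
of the grouped sum is g_r - g_(-r), which vanishes at r = 0. *)
Lemma finite_theta_telescope N r : (r <= N)%N ->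
  (1 - q ^+ (12 * N + 12)) * (1 - q ^+ (12 * N + 18)) *
    (finite_theta_coef N.+1 r * (1 - q ^+ (2 * r + 1))) -
  (1 - q ^+ (6 * N + 7)) * (1 - q ^+ (6 * N + 5)) *
    (finite_theta_coef N r * (1 - q ^+ (2 * r + 1))) =
  finite_theta_cert N r.+1 - finite_theta_cert N r.
Proof.
move=> /subnK <-; move: (N - r)%N => k {N}.
have P_unit n : P n \is a GRing.unit by rewrite unit_qprod.
have invP n : (P n)^-1 = (1 - q ^+ (6 + 6 * n)) * (P n.+1)^-1.
  by rewrite inv_qprod_recr.
rewrite /finite_theta_cert /finite_theta_coef !invrM //.
have -> : ((k + r).+1 - r = k.+1)%N by lia.
have -> : ((k + r).+1 - r.+1 = k)%N by lia.
have -> : ((k + r) - r = k)%N by lia.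
have -> : ((k + r).+1 + r.+1 + 1 = (k + 2 * r).+3)%N by lia.
have -> : ((k + r).+1 + r + 1 = (k + 2 * r).+2)%N by lia.
have -> : (k + r + r + 1 = (k + 2 * r).+1)%N by lia.
rewrite (invP k) (invP (k + 2 * r).+1) (invP (k + 2 * r).+2).
move: (_^-1) (_^-1) => P1 P2.
have -> : (3 * r.+1 ^ 2 + 2 * r.+1 = (3 * r ^ 2 + 2 * r) + 6 * r + 5)%N by ring.
move: (3 * r ^ 2 + 2 * r)%N => M.
have -> : (6 + 6 * k = 6 * k + 6)%N by lia.
have -> : (6 * k.+1 = 6 * k + 6)%N by lia.
have -> : (6 + 6 * (k + 2 * r).+1 = 6 * k + 12 * r + 12)%N by lia.
have -> : (6 + 6 * (k + 2 * r).+2 = 6 * k + 12 * r + 18)%N by lia.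
have -> : (12 * (k + r) = 12 * k + 12 * r)%N by lia.
have -> : (6 * (k + r) = 6 * k + 6 * r)%N by lia.
have -> : (6 * (k + r + r.+1 + 2) = 6 * k + 12 * r + 18)%N by lia.
have -> : (6 * (k + r + r + 2) = 6 * k + 12 * r + 12)%N by lia.
have -> : (2 * r.+1 = 2 * r + 2)%N by lia.
have -> : (6 * r.+1 = 6 * r + 6)%N by lia.
have -> : (8 * r.+1 = 8 * r + 8)%N by lia.
have pw c n : q ^+ (c * n) = (q ^+ n) ^+ c by rewrite mulnC exprM.
rewrite (exprS (-1)).
have := (pw 6 k, pw 12 k, pw 2 r, pw 6 r, pw 8 r, pw 12 r).
move: (6 * k)%N (12 * k)%N (2 * r)%N (6 * r)%N (8 * r)%N (12 * r)%N => {pw}.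
move=> a6 a12 b2 b6 b8 b12 pw.
rewrite !(exprD q) !pw.
move: (q ^+ M) (q ^+ k) (q ^+ r) ((-1) ^+ r : R) => m z x sg.
ring.
Qed.

(** The sum for N + 1 has one more term than the sum for N.  This last term
cancels the boundary value of the certificate. *)
Lemma finite_theta_rec N :
  (1 - q ^+ (12 * N + 12)) * (1 - q ^+ (12 * N + 18)) * finite_theta N.+1 =
  (1 - q ^+ (6 * N + 7)) * (1 - q ^+ (6 * N + 5)) * finite_theta N.
Proof.
apply/eqP; rewrite -subr_eq0 /finite_theta big_ord_recr /=.
rewrite mulrDr addrAC !mulr_sumr -sumrB.
under eq_bigr => r _ do rewrite finite_theta_telescope -1?ltnS //.
rewrite -(big_mkord xpredT
  (fun r => finite_theta_cert N r.+1 - finite_theta_cert N r)).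
rewrite telescope_sumr // /finite_theta_cert !muln0 !subnn muln0 !expr0.
rewrite !subrr !mulr0 addr0 mulr0 subr0.
have -> : (6 * (N + N.+1 + 2) = 12 * N + 18)%N by lia.
have -> : (2 * N.+1 + 1 = 2 * N + 3)%N by lia.
have -> : (6 * N.+1 = 6 * N + 6)%N by lia.
have -> : (2 * N.+1 = 2 * N + 2)%N by lia.
have -> : (8 * N.+1 = 8 * N + 8)%N by lia.
have pw c n : q ^+ (c * n) = (q ^+ n) ^+ c by rewrite mulnC exprM.
have := (pw 12 N, pw 2 N, pw 6 N, pw 8 N).
move: (finite_theta_coef _ _) => c.
move: (12 * N)%N (2 * N)%N (6 * N)%N (8 * N)%N => b12 b2 b6 b8 {}pw.
by rewrite !(exprD q) !pw; apply/eqP; ring.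
Qed.

Lemma finite_theta_prod N :
  finite_theta N * P (2 * N + 1) = qprod (-1) 1 6 N.+1 * qprod (-1) 5 6 N.
Proof.
elim: N => [|N IHN].
  have U6 : 1 - q ^+ 6 \is a GRing.unit by rewrite unit_one_sub.
  rewrite /finite_theta big_ord1 /finite_theta_coef muln0 !add0n.
  rewrite !(qprod_recr _ _ 6) !qprod0.
  by rewrite !muln0 !addn0 !mul1r !mulN1r mulr1 mulrAC mulVr ?mul1r.
have -> : (2 * N.+1 + 1 = (2 * N + 1).+2)%N by lia.
rewrite !(qprod_recr _ _ 6) -(qprod_recr _ 1 6).
transitivity (((1 - q ^+ (12 * N + 12)) * (1 - q ^+ (12 * N + 18)) *
               finite_theta N.+1) * P (2 * N + 1)).
  have -> : (6 + 6 * (2 * N + 1) = 12 * N + 12)%N by lia.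
  have -> : (6 + 6 * (2 * N + 1).+1 = 12 * N + 18)%N by lia.
  by ring.
rewrite finite_theta_rec -mulrA IHN.
have -> : (1 + 6 * N.+1 = 6 * N + 7)%N by lia.
have -> : (5 + 6 * N = 6 * N + 5)%N by lia.
by ring.
Qed.

(** The limit of the finite form.  If 2r >= K, the r-th term is zero because of
its power of q; otherwise 6 (K - r) >= K, and the finite products in the
denominator have already reached their limits. *)
Lemma theta_prod : theta = qinf (-1) 1 6 * qinf (-1) 5 6 * qinf (-1) 6 6.
Proof.
have P_inf n : (K <= 6 * n + 6)%N -> P n = qinf (-1) 6 6.
  move=> le_K; have [le_nK|/ltnW lt_Kn] := leqP n K.
    by apply/esym/qprod_stable; rewrite // addnC.
  by apply: qprod_stable => //; lia.
have UP : qinf (-1) 6 6 \is a GRing.unit by rewrite unit_qinf.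
have := finite_theta_prod K; rewrite P_inf; last by lia.
rewrite [qprod (-1) 1 6 K.+1](_ : _ = qinf (-1) 1 6); last first.
  by apply: qprod_stable => //; lia.
have -> : finite_theta K = theta / (qinf (-1) 6 6 * qinf (-1) 6 6).
  rewrite /finite_theta /theta big_ord_recr /= {2}/finite_theta_coef.
  rewrite expq_ge ?(mulr0, mul0r); last by nia.
  rewrite addr0 mulr_suml; apply: eq_bigr => r _; rewrite /finite_theta_coef.
  have [le_K2r|lt_2rK] := leqP K (2 * r).
    by rewrite (@expq_ge (3 * r ^ 2 + _)) ?(mulr0, mul0r) //; lia.
  by rewrite !P_inf 1?mulrAC //; lia.
rewrite invrM // mulrA divrK // => /(canRL (divrK UP)) => ->.
by rewrite /qinf.
Qed.

(** Since (-q; q)_{2r} (1 + q^(2r+1)) (-q^(2r+2); q)_oo = (-q; q)_oo and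
(q^2; q^2)_r (q^(2r+2); q^2)_oo = (q^2; q^2)_oo, at z = 1 every term has the
factor (-q; q)_oo / (q^2; q^2)_oo = 1 / (q; q)_oo. *)
Lemma series0_theta : series 0 * qinf (-1) 1 1 = theta.
Proof.
rewrite /series /theta mulr_suml; apply: eq_bigr => r _.
rewrite /series_term /series_monomial !muln0 mul0n !add0n.
have := qinf_mulN.
rewrite (qinf_split (-1) 2 r) // (qinf_split 1 1 (2 * r).+1) //.
rewrite (qprod_recr 1) !mul1n add1n [(2 + _)%N]addnC.
rewrite [(1 + _)%N](_ : _ = 2 * r + 2)%N; last by lia.
have UQ := unit_qprod (-1) 2 r (isT : (0 < 2)%N).
have UD : qinf (-1) (2 * r + 2) 2 \is a GRing.unit by rewrite unit_qinf ?addn2.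
move: UQ UD; set Q := qprod (-1) _ _ r; set D := qinf _ _ 2.
set N := qprod _ _ _ _; set E := qinf _ _ 1; set F := qinf _ _ _ => UQ UD eqQD.
have -> : (4 * r + 2 = (2 * r).+1 * 2)%N by lia.
rewrite exprM addn1; set y := q ^+ (2 * r).+1 in eqQD *; set m := _ * q ^+ _.
have {eqQD}: F * N * (1 + y) * E * (Q^-1 * D^-1) = 1.
  have -> : F * N * (1 + y) * E = Q * D by rewrite eqQD; ring.
  by rewrite mulrACA !divrr // mulr1.
move: (Q^-1) (D^-1) => Qi Di eq1.
transitivity (m * (1 - y) * (F * N * (1 + y) * E * (Qi * Di))); first by ring.
by rewrite eq1 mulr1.
Qed.

Lemma series0_inv :
  series 0 * (qinf (-1) 2 6 * qinf (-1) 3 6 * qinf (-1) 4 6) = 1.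
Proof.
have qsplit : qinf (-1) 1 1 = qinf (-1) 1 6 * qinf (-1) 2 6 * qinf (-1) 3 6
    * qinf (-1) 4 6 * qinf (-1) 5 6 * qinf (-1) 6 6.
  by rewrite -qprod_mod6; apply/esym/qprod_stable; lia.
have := series0_theta; rewrite qsplit theta_prod => eq0.
have U : qinf (-1) 1 6 * qinf (-1) 5 6 * qinf (-1) 6 6 \is a GRing.unit.
  by rewrite !unitrM !unit_qinf.
by apply: (mulIr U); rewrite mul1r -[RHS]eq0; ring.
Qed.

(** * Generating functions of weighted sequences *)

Definition weight_gf k m : R :=
  \sum_(0 <= n < K) (weight_count k m n)%:R * q ^+ n.

(** Prepending x to a sequence adds x to its sum; the terms that pass the order
of truncation vanish. *)
Lemma weight_gf_shift k x : (0 < x)%N -> q ^+ x * weight_gf k x =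
  \sum_(1 <= n < K | (x <= n)%N) (weight_count k x (n - x))%:R * q ^+ n.
Proof.
move=> x_gt0; have K_gt0 := truncation_gt0.
transitivity (\sum_(x <= n < K + x) (weight_count k x (n - x))%:R * q ^+ n).
  rewrite [RHS](big_addn 0 (K + x) x) addnK mulr_sumr; apply: eq_bigr => j _.
  by rewrite addnK mulrCA -exprD addnC.
have [le_xK|lt_Kx] := leqP x K.
  rewrite (big_cat_nat (n := K)) ?leq_addr //= [X in _ + X]big_nat.
  rewrite [X in _ + X]big1 => [|n /andP[le_Kn _]].
    by rewrite addr0 (big_nat_widenl x 1).
  by rewrite expq_ge ?mulr0.
rewrite [LHS]big_nat [LHS]big1 => [|n /andP[le_xn _]]; last first.
  by rewrite expq_ge ?mulr0 //; lia.
rewrite big_nat_cond big1 // => n /andP[/andP[_ lt_nK] le_xn]; lia.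
Qed.

(** The sequences are sorted by their first part x. *)
Lemma weight_gfE k m :
  weight_gf k m = 1 + \sum_(1 <= x < K) (k m x)%:R * (q ^+ x * weight_gf k x).
Proof.
have K_gt0 := truncation_gt0.
rewrite /weight_gf big_ltn // weight_count0 mulr1; congr (_ + _).
under [RHS]eq_big_nat => x /andP[x_gt0 _].
  rewrite weight_gf_shift // mulr_sumr; over.
rewrite (exchange_big_dep_nat xpredT) //=.
apply: eq_big_nat => -[|n] // /andP[_ lt_nK].
rewrite weight_countS natr_sum mulr_suml (big_nat_widen 1 n.+2 K) //.
by apply: eq_big => x; rewrite ?andTb ?ltnS // natrM mulrA.
Qed.

Lemma weight_gf_ge k m :
    (K <= m)%N -> (forall x, (x < m)%N -> k m x = 0) ->
  weight_gf k m = 1.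
Proof.
move=> le_Km k0; rewrite weight_gfE big_nat big1 ?addr0 // => x /andP[_ lt_xK].
by rewrite k0 ?mul0r // (leq_trans lt_xK).
Qed.

(** Two starting values give the same weights to the sequences, except where
the first factor differs. *)
Lemma weight_gf_rec k m m' (d : nat -> nat) :
    (forall x, (0 < x)%N -> k m x = k m' x + d x)%N ->
  weight_gf k m =
  weight_gf k m' + \sum_(1 <= x < K) (d x)%:R * (q ^+ x * weight_gf k x).
Proof.
move=> k_d; rewrite (weight_gfE _ m) (weight_gfE _ m') -addrA -big_split.
congr (_ + _); apply: eq_big_nat => x /andP[x_gt0 _].
by rewrite k_d // natrD mulrDl.
Qed.

Lemma sum_pick (b : bool) a (F : nat -> R) : (0 < a)%N ->
  \sum_(1 <= x < K) (b && (x == a))%:R * (q ^+ x * F x) = b%:R * (q ^+ a * F a).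
Proof.
move=> a_gt0; case: b; last first.
  by rewrite mul0r big1 // => x _; rewrite mul0r.
rewrite mul1r; have [lt_aK|le_Ka] := ltnP a K; last first.
  rewrite expq_ge // mul0r big_nat big1 // => x /andP[_ lt_xK].
  by rewrite ltn_eqF ?mul0r // (leq_trans lt_xK).
rewrite (bigD1_seq a) ?mem_index_iota ?a_gt0 ?iota_uniq //= eqxx mul1r.
by rewrite big1 ?addr0 // => x /negbTE->; rewrite mul0r.
Qed.

(** A sequence of parts >= m has no part m, or, if m is allowed, a first part m
to be removed. *)
Lemma A61_gf_rec m :
  (1 - (A61_part m)%:R * q ^+ m) * weight_gf A61_kernel m =
  weight_gf A61_kernel m.+1.
Proof.
case: m => [|m].
  rewrite (_ : A61_part 0 = false) // mul0r subr0 mul1r.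
  rewrite !weight_gfE; congr (_ + _); apply: eq_big_nat => x /andP[x_gt0 _].
  by rewrite /A61_kernel x_gt0.
rewrite mulrBl mul1r.
rewrite {1}(@weight_gf_rec _ _ m.+2 (fun x => A61_part m.+1 && (x == m.+1))).
  by rewrite sum_pick // mulrA addrK.
move=> x _; rewrite /A61_kernel; have [->|] := eqVneq x m.+1.
  by rewrite leqnn ltnn andbT.
rewrite andbF addn0 eq_sym => ne_x.
by rewrite [(m.+1 <= x)%N]leq_eqVlt (negbTE ne_x).
Qed.

Lemma A61_gf_ge m : (K <= m)%N -> weight_gf A61_kernel m = 1.
Proof.
move=> le_Km; apply: weight_gf_ge => // x lt_xm.
by rewrite /A61_kernel leqNgt lt_xm.
Qed.

(** Six steps of the recursion cross one period modulo 6. *)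
Lemma A61_gf_inv :
  weight_gf A61_kernel 1 *
    (qinf (-1) 2 6 * qinf (-1) 3 6 * qinf (-1) 4 6) = 1.
Proof.
move: (weight_gf A61_kernel) A61_gf_rec A61_gf_ge => u u_rec u_ge.
suff u_step n :
    u 1%N * (qprod (-1) 2 6 n * qprod (-1) 3 6 n * qprod (-1) 4 6 n)
    = u (6 * n + 1)%N.
  by rewrite u_step u_ge //; lia.
elim: n => [|n IHn]; first by rewrite !qprod0 !mulr1.
have A_mod k : A61_part (6 * n + k) = A61_part k.
  by rewrite /A61_part -addnA mulnC !modnMDl.
have -> : (6 * n.+1 + 1 = (6 * n + 6).+1)%N by lia.
have {}u_rec k : u (6 * n + k.+2)%N =
    (1 - (A61_part k.+1)%:R * q ^+ (6 * n + k.+1)) * u (6 * n + k.+1)%N.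
  by rewrite [in LHS]addnS -u_rec A_mod.
rewrite -addnS !u_rec -IHn -[A61_part 1]/false -[A61_part 2]/true.
rewrite -[A61_part 3]/true -[A61_part 4]/true.
rewrite -[A61_part 5]/false -[A61_part 6]/false.
rewrite !(qprod_recr _ _ 6) !mulN1r ![(_ + 6 * n)%N]addnC.
move: (6 * n)%N => m.
have -> : true%:R = 1 :> R by [].
have -> : false%:R = 0 :> R by [].
ring.
Qed.

Let V := weight_gf R2_kernel.

(** Raising the starting value from m to m + 1 changes the factor of two first
parts only: m + 2 is no longer allowed, and m + 3, now at distance 2, loses its
factor 2 when it is even. *)
Lemma R2_gf_step m :
  V m = V m.+1 + q ^+ (m + 2) * V (m + 2) +
        (odd m)%:R * (q ^+ (m + 3) * V (m + 3)).
Proof.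
rewrite {1}/V (@weight_gf_rec _ _ m.+1
  (fun x => (true && (x == m + 2)) + (odd m && (x == m + 3)))%N).
  under [X in _ + X]eq_bigr => x _ do rewrite natrD mulrDl.
  by rewrite big_split !sum_pick ?addn2 ?addn3 //= mul1r addrA.
move=> x _; rewrite /R2_kernel; have [->|ne2] := eqVneq x (m + 2)%N.
  by rewrite leqnn andbF /=; case: ifP; rewrite /= ?andbF; lia.
have [->|ne3] := eqVneq x (m + 3)%N.
  have -> : (m + 3 == m.+1 + 2)%N by lia.
  have -> : (m + 2 <= m + 3)%N by lia.
  have -> : (m.+1 + 2 <= m + 3)%N by lia.
  by rewrite oddD andbF /= !andbT; case: (odd m).
have -> : (x == m.+1 + 2)%N = false by lia.
rewrite !andbF /= !addn0.
have -> : (m.+1 + 2 <= x)%N = (m + 2 <= x)%N by lia.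
by [].
Qed.

(** The odd values V(2l+1) and V(2l+3) are eliminated between the steps from
2l, 2l+1 and 2l+2. *)
Lemma R2_gf_even l :
  V (2 * l) = (1 + q ^+ (2 * l + 2) + q ^+ (2 * l + 3)) * V (2 * l.+1)
           + q ^+ (2 * l + 4) * (1 - q ^+ (2 * l + 3)) * V (2 * l.+2).
Proof.
have := (R2_gf_step (2 * l), R2_gf_step (2 * l).+1, R2_gf_step (2 * l).+2).
have -> : (2 * l.+1 = (2 * l).+2)%N by lia.
have -> : (2 * l.+2 = (2 * l).+4)%N by lia.
rewrite /= oddM /=; move: (2 * l)%N => m.
rewrite !addn2 !addn3 addn4 !mul0r !addr0 mul1r.
case=> [[E0 E1] E2]; rewrite E0 E1.
have {}E2 : V m.+3 = V m.+2 - q ^+ m.+4 * V m.+4 by rewrite E2 addrK.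
rewrite E2; ring.
Qed.

Lemma R2_gf_ge m : (K <= m)%N -> V m = 1.
Proof.
move=> le_Km; apply: weight_gf_ge => // x lt_xm.
by rewrite /R2_kernel leqNgt ltn_addr.
Qed.

Lemma A61_gf_eq_R2_gf : weight_gf A61_kernel 1 = weight_gf R2_kernel 0.
Proof.
have unitP : qinf (-1) 2 6 * qinf (-1) 3 6 * qinf (-1) 4 6 \is a GRing.unit.
  by rewrite !unitrM !unit_qinf.
apply: (mulIr unitP); rewrite A61_gf_inv.
rewrite -[LHS](series0_inv); congr (_ * _); apply/esym.
rewrite -[0%N in LHS](muln0 2).
apply: (series_unique (f := fun l => V (2 * l))) => [l|l le_K].
  exact: R2_gf_even.
exact: R2_gf_ge.
Qed.

End TruncatedSeries.

Section CoefficientExtraction.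
Local Open Scope ring_scope.

(** With q the class of X modulo X^(n+2), the generating function is
represented by a polynomial of degree at most n + 1, and its coefficient of
X^n can be read off. *)
Lemma weight_count_eq k k' m m' :
    (forall (R : comUnitRingType) (q : R) K, q ^+ K = 0 ->
       weight_gf q K k m = weight_gf q K k' m') ->
  weight_count k m =1 weight_count k' m'.
Proof.
move=> eq_gf n; pose h : {poly rat} := 'X^(n.+2).
have h_monic : h \is monic by exact: monicXn.
have mk_h : mk_monic h = h by rewrite /mk_monic h_monic size_polyXn.
pose q : {poly %/ h} := in_qpoly h 'X.
have qK : q ^+ n.+2 = 0.
  apply/val_inj; rewrite -rmorphXn /= mk_h.
  exact: Pdiv.RingMonic.rmodpp.
have coef_gf k0 m0 :
    (weight_gf q n.+2 k0 m0 : {poly rat})`_n = (weight_count k0 m0 n)%:R.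
  have -> : weight_gf q n.+2 k0 m0 =
      in_qpoly h (\poly_(i < n.+2) (weight_count k0 m0 i)%:R).
    rewrite poly_def rmorph_sum /= /weight_gf big_mkord.
    apply: eq_bigr => i _.
    by rewrite -mul_polyC -rmorphXn /= rmorphM polyC_natr rmorph_nat.
  rewrite in_qpoly_small ?coef_poly ?leqnSn //.
  by rewrite mk_h size_polyXn ltnS size_poly.
have /(congr1 (fun p : {poly %/ h} => (p : {poly rat})`_n)) := eq_gf _ _ _ qK.
rewrite !coef_gf => /eqP; rewrite (eqr_nat rat) => /eqP.
exact.
Qed.

End CoefficientExtraction.

Theorem theorem2 (n : nat) :
  A61 n = \sum_(p : intpart n | R2 p) omega2 p.
Proof.
rewrite A61_count R2_count; apply: weight_count_eq => R q K qK.
exact: A61_gf_eq_R2_gf.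
Qed.
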